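(* Let $d\geqslant 1$ be an integer. Suppose the ideal of relations of $A$ is generated in degrees $\leqslant d$. If a graded $A$-module $V$ is presented in finite degrees, then $V$ is $d$-step centrally stable.
   Context: $R$ is a commutative ring and $\mathbb{Z}_+$ is the set of non-negative integers. $\mathcal{A}$ is an $R$-linear category (a category enriched over $R$-modules) with $\operatorname{Ob}(\mathcal{A})=\mathbb{Z}_+$ and $\operatorname{Hom}_{\mathcal{A}}(m,n)=0$ whenever $m>n$. Its category algebra is the (non-unital) $R$-algebra $A=\bigoplus_{m,n\in\mathbb{Z}_+}\operatorname{Hom}_{\mathcal{A}}(m,n)$, with product given by composition (and zero when morphisms are not composable). For $n\in\mathbb{Z}_+$, $e_n\in A$ is the identity endomorphism of $n$; for $m\leqslant n$, $e_{m,n}:=e_m+e_{m+1}+\cdots+e_n$. A graded $A$-module is an $A$-module $V$ with $V=\bigoplus_{n\in\mathbb{Z}_+}e_nV$. It is presented in finite degrees if for some $N\in\mathbb{Z}_+$ there is an exact sequence of $A$-modules $\bigoplus_{j\in J}Ae_{0,N}\to\bigoplus_{i\in I}Ae_{0,N}\to V\to 0$, where $I,J$ may be finite or infinite. It is $d$-step centrally stable if for all $N$ sufficiently large one has $$Ae\otimes_{eAe}eV\cong\bigoplus_{n\geqslant N-(d-1)}e_nV\quad\text{where } e=e_{N-(d-1),N}$$ (as $A$-modules; the right-hand side is an $A$-submodule of $V$). Ideal of relations. Set $\widetilde{\mathcal{A}}(m,m):=\operatorname{End}_{\mathcal{A}}(m)$ and, for $n\geqslant m+1$, $$\widetilde{\mathcal{A}}(m,n):=\operatorname{Hom}_{\mathcal{A}}(n-1,n)\otimes_{\operatorname{End}_{\mathcal{A}}(n-1)}\cdots\otimes_{\operatorname{End}_{\mathcal{A}}(m+1)}\operatorname{Hom}_{\mathcal{A}}(m,m+1).$$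 These are the Hom-modules (with $\operatorname{Hom}(m,n)=0$ for $m>n$) of an $R$-linear category $\widetilde{\mathcal{A}}$ on the objects $\mathbb{Z}_+$, with composition by concatenation of tensors, and composition in $\mathcal{A}$ gives a natural $R$-linear functor $\widetilde{\mathcal{A}}\to\mathcal{A}$ that is the identity on objects. For $n\geqslant m$ let $\widetilde{I}(m,n)$ be the kernel of $\widetilde{\mathcal{A}}(m,n)\to\operatorname{Hom}_{\mathcal{A}}(m,n)$. For an integer $d\geqslant 1$, the ideal of relations of $A$ is generated in degrees $\leqslant d$ if, whenever $n\geqslant m+2$, the map $\widetilde{\mathcal{A}}(m,n)\to\operatorname{Hom}_{\mathcal{A}}(m,n)$ is surjective, and, whenever $n\geqslant m+d$, $$\widetilde{I}(m,n)=\sum_{r=m}^{n-d}\widetilde{\mathcal{A}}(r+d,n)\otimes_{\operatorname{End}_{\mathcal{A}}(r+d)}\widetilde{I}(r,r+d)\otimes_{\operatorname{End}_{\mathcal{A}}(r)}\widetilde{\mathcal{A}}(m,r),$$ where each summand denotes its image in $\widetilde{\mathcal{A}}(m,n)$ under concatenation. *)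

(* Defs.v *)
From HB Require Import structures.
From mathcomp Require Import all_boot all_order all_algebra.
From mathcomp Require Import boolp classical_sets functions cardinality.

Set Implicit Arguments.
Unset Strict Implicit.
Unset Printing Implicit Defensive.

Import GRing.Theory.
Local Open Scope ring_scope.
Local Open Scope quotient_scope.

Lemma linear_sumE (R : pzRingType) (U V : lmodType R) (f : U -> V) :
  linear f -> forall (J : Type) (s : seq J) (F : J -> U),
  f (\sum_(i <- s) F i) = \sum_(i <- s) f (F i).
Proof.
move=> fl J s F; have f0 : f 0 = 0.
  by have := fl (-1) 0 0; rewrite scaler0 add0r scaleN1r addNr.
elim: s => [|x s IHs]; rewrite ?big_nil ?big_cons //.
by have := fl 1 (F x) (\sum_(i <- s) F i); rewrite !scale1r IHs.
Qed.

(* [tens ra la] is the tensor product over [S] of the [R]-modules [M] and [N],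
   where [S] acts on [M] from the right by [ra] and on [N] from the left by
   [la].  A formal sum of pure tensors is a list of pairs, and [teq] is the
   [R]-linear congruence on formal sums generated by bilinearity and balancing.
   Formal sums are only a monoid, which is why [teq_0] is listed: the opposite
   is obtained by scaling by [-1]. *)
Section Tensor.
Context {R : comPzRingType} {M N : lmodType R} {S : Type}.
Variables (ra : M -> S -> M) (la : S -> N -> N).

Definition fscale (a : R) (s : seq (M * N)) := [seq (a *: p.1, p.2) | p <- s].

Inductive teq : seq (M * N) -> seq (M * N) -> Prop :=
| teq_refl s : teq s s
| teq_sym s t : teq s t -> teq t s
| teq_trans s t u : teq s t -> teq t u -> teq s u
| teq_cat s s' t t' : teq s s' -> teq t t' -> teq (s ++ t) (s' ++ t')
| teq_fscale a s t : teq s t -> teq (fscale a s) (fscale a t)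
| teq_comm s t : teq (s ++ t) (t ++ s)
| teq_0 y : teq [:: (0, y)] [::]
| teq_addl x x' y : teq [:: (x + x', y)] [:: (x, y); (x', y)]
| teq_addr x y y' : teq [:: (x, y + y')] [:: (x, y); (x, y')]
| teq_scale a x y : teq [:: (a *: x, y)] [:: (x, a *: y)]
| teq_bal x s y : teq [:: (ra x s, y)] [:: (x, la s y)].

Definition teqb : rel (seq (M * N)) := fun s t => `[< teq s t >].

Lemma teqb_refl : reflexive teqb.
Proof. by move=> s; apply/asboolP; apply: teq_refl. Qed.

Lemma teqb_sym : symmetric teqb.
Proof. by move=> s t; apply/asboolP/asboolP; apply: teq_sym. Qed.

Lemma teqb_trans : transitive teqb.
Proof.
by move=> t s u /asboolP st /asboolP tu; apply/asboolP; apply: teq_trans st tu.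
Qed.

Canonical teqb_equiv := EquivRel teqb teqb_refl teqb_sym teqb_trans.

Definition tens : Type := {eq_quot teqb}.
HB.instance Definition _ := Choice.on tens.
HB.instance Definition _ := Quotient.on tens.

Definition tcls (s : seq (M * N)) : tens := \pi_tens s.
Definition trep (t : tens) : seq (M * N) := repr t.
Definition tpure (x : M) (y : N) : tens := tcls [:: (x, y)].

Lemma trepK t : tcls (trep t) = t.
Proof. exact: reprK. Qed.

Lemma tclsP s t : tcls s = tcls t <-> teq s t.
Proof.
rewrite -[teq s t]asboolE -/(teqb s t); split.
  by move/(@eqmodP _ teqb_equiv).
by move=> st; apply/(@eqmodP _ teqb_equiv).
Qed.

Lemma teq_trep s : teq (trep (tcls s)) s.
Proof. by apply/tclsP; rewrite trepK. Qed.

Definition tadd (t u : tens) := tcls (trep t ++ trep u).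
Definition tscale (a : R) (t : tens) := tcls (fscale a (trep t)).

Lemma tadd_cls s t : tadd (tcls s) (tcls t) = tcls (s ++ t).
Proof. by apply/tclsP; apply: teq_cat; apply: teq_trep. Qed.

Lemma tscale_cls a s : tscale a (tcls s) = tcls (fscale a s).
Proof. by apply/tclsP; apply: teq_fscale; apply: teq_trep. Qed.

Lemma taddA : associative tadd.
Proof.
move=> t u v; rewrite -[t]trepK -[u]trepK -[v]trepK.
by rewrite !tadd_cls catA.
Qed.

Lemma taddC : commutative tadd.
Proof.
move=> t u; rewrite -[t]trepK -[u]trepK !tadd_cls.
by apply/tclsP/teq_comm.
Qed.

Lemma tadd0 : left_id (tcls [::]) tadd.
Proof. by move=> t; rewrite -[t]trepK tadd_cls. Qed.

Lemma teq_fscaleD a b s : teq (fscale (a + b) s) (fscale a s ++ fscale b s).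
Proof.
elim: s => [|[x y] s IHs] /=; first exact: teq_refl.
rewrite -cat1s; apply: teq_trans (teq_cat _ IHs) _.
  by rewrite scalerDl; apply: teq_addl.
apply: (@teq_cat [:: _] [:: _] (_ :: _)); first exact: teq_refl.
rewrite -!/(fscale _ _) -cat1s catA -[X in teq _ (_ ++ X)]cat1s catA.
exact: teq_cat (teq_comm _ _) (teq_refl _).
Qed.

Lemma teq_fscale0 s : teq (fscale 0 s) [::].
Proof.
elim: s => [|[x y] s IHs] /=; first exact: teq_refl.
rewrite -cat1s -[X in teq _ X]cat0s; apply: teq_cat IHs.
by rewrite scale0r; apply: teq_0.
Qed.

Lemma tscale1 : left_id 1 tscale.
Proof.
move=> t; rewrite -[t]trepK tscale_cls /fscale -[in RHS](map_id (trep t)).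
by congr tcls; apply: eq_map => -[x y] /=; rewrite scale1r.
Qed.

Lemma taddN : left_inverse (tcls [::]) (tscale (- 1)) tadd.
Proof.
move=> t; rewrite -{2}[t]tscale1 -[t]trepK !tscale_cls tadd_cls.
apply/tclsP; apply: teq_trans (teq_sym (teq_fscaleD _ _ _)) _.
by rewrite addNr; apply: teq_fscale0.
Qed.

HB.instance Definition _ := GRing.isZmodule.Build tens taddA taddC tadd0 taddN.

Lemma tscaleA a b t : tscale a (tscale b t) = tscale (a * b) t.
Proof.
rewrite -[t]trepK !tscale_cls /fscale -map_comp.
by congr tcls; apply: eq_map => p /=; rewrite scalerA.
Qed.

Lemma tscaleDr : right_distributive tscale +%R.
Proof.
move=> a t u; change (tscale a (tadd t u) = tadd (tscale a t) (tscale a u)).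
rewrite -[t]trepK -[u]trepK !(tadd_cls, tscale_cls).
by rewrite /fscale map_cat.
Qed.

Lemma tscaleDl t : {morph tscale^~ t : a b / a + b}.
Proof.
move=> a b; change (tscale (a + b) t = tadd (tscale a t) (tscale b t)).
rewrite -[t]trepK !tscale_cls tadd_cls.
by apply/tclsP/teq_fscaleD.
Qed.

HB.instance Definition _ :=
  GRing.Zmodule_isLmodule.Build R tens tscaleA tscale1 tscaleDr tscaleDl.

Lemma tscaleE a t : tscale a t = a *: t.
Proof. by []. Qed.

Lemma tcls_cat s t : tcls (s ++ t) = tcls s + tcls t.
Proof. by rewrite -tadd_cls. Qed.

Lemma tclsE s : tcls s = \sum_(p <- s) tpure p.1 p.2.
Proof.
elim: s => [|[x y] s IHs]; first by rewrite big_nil.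
by rewrite big_cons -cat1s tcls_cat IHs.
Qed.

Lemma tensE t : t = \sum_(p <- trep t) tpure p.1 p.2.
Proof. by rewrite -tclsE trepK. Qed.

Definition balanced (P : lmodType R) (f : M -> N -> P) : Prop :=
  [/\ forall y, linear (f^~ y), forall x, linear (f x)
    & forall x s y, f (ra x s) y = f x (la s y)].

Lemma tpure_balanced : balanced tpure.
Proof.
split=> [y a x x'|x a y y'|x s y]; last by apply/tclsP/teq_bal.
- rewrite -tscaleE tscale_cls -tcls_cat.
  by apply/tclsP/teq_addl.
rewrite -tscaleE tscale_cls /= -tcls_cat.
apply/tclsP; apply: teq_trans (teq_addr _ _ _) _.
by apply: (@teq_cat [:: _] [:: _] [:: _] [:: _]);
  [apply: teq_sym; apply: teq_scale | apply: teq_refl].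
Qed.

(* The linear map out of the tensor product induced by [f]; it is meaningful
   when [f] is balanced, cf. [tlift_pure] and [tlift_linear]. *)
Definition tlift (P : lmodType R) (f : M -> N -> P) (t : tens) : P :=
  \sum_(p <- trep t) f p.1 p.2.

Lemma tlift_cls (P : lmodType R) (f : M -> N -> P) s : balanced f ->
  tlift f (tcls s) = \sum_(p <- s) f p.1 p.2.
Proof.
move=> [fl fr fb]; rewrite /tlift.
have f0 y : f 0 y = 0.
  by have := fl y (-1) 0 0; rewrite scaler0 add0r scaleN1r addNr.
have fD x x' y : f (x + x') y = f x y + f x' y.
  by have := fl y 1 x x'; rewrite !scale1r.
have fZ a x y : f (a *: x) y = a *: f x y.
  by have := fl y a x 0; rewrite f0 !addr0.
have f0' x : f x 0 = 0.
  by have := fr x (-1) 0 0; rewrite scaler0 add0r scaleN1r addNr.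
move: (trep _) (teq_trep s) => s'; elim=> {s s'} //=.
- by move=> s t u _ -> _ ->.
- by move=> s s' t t' _ ss _ tt; rewrite !big_cat /= ss tt.
- move=> a s t _ st; rewrite /fscale !big_map /=.
  under eq_bigr do rewrite fZ.
  under [in RHS]eq_bigr do rewrite fZ.
  by rewrite -!scaler_sumr st.
- by move=> s t; rewrite !big_cat /= addrC.
- by move=> y; rewrite big_seq1 big_nil.
- by move=> x x' y; rewrite !big_cons !big_nil /= !addr0.
- move=> x y y'; rewrite !big_cons !big_nil /= !addr0.
  by have := fr x 1 y y'; rewrite !scale1r.
- move=> a x y; rewrite !big_seq1 /= fZ.
  by have := fr x a y 0; rewrite f0' !addr0.
- by move=> x s y; rewrite !big_seq1 /= fb.
Qed.

Lemma tlift_pure (P : lmodType R) (f : M -> N -> P) x y : balanced f ->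
  tlift f (tpure x y) = f x y.
Proof. by move=> fb; rewrite tlift_cls // big_seq1. Qed.

Lemma tlift_linear (P : lmodType R) (f : M -> N -> P) : balanced f ->
  linear (tlift f).
Proof.
move=> fb a t u; rewrite -[t]trepK -[u]trepK.
rewrite -tscaleE tscale_cls -tcls_cat !tlift_cls // big_cat /=.
congr (_ + _); rewrite /fscale big_map scaler_sumr; apply: eq_bigr => p _ /=.
have [fl _ _] := fb; have f0 : f 0 p.2 = 0.
  by have := fl p.2 (-1) 0 0; rewrite scaler0 add0r scaleN1r addNr.
by have := fl p.2 a p.1 0; rewrite f0 !addr0.
Qed.

Lemma tens_ext (P : lmodType R) (f g : tens -> P) : linear f -> linear g ->
  (forall x y, f (tpure x y) = g (tpure x y)) -> f =1 g.
Proof.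
have lin0 (h : tens -> P) : linear h -> h 0 = 0.
  by move=> hl; have := hl (-1) 0 0; rewrite scaler0 add0r scaleN1r addNr.
have linD (h : tens -> P) : linear h -> forall t u, h (t + u) = h t + h u.
  by move=> hl t u; have := hl 1 t u; rewrite !scale1r.
move=> fl gl fg t; rewrite [t]tensE.
elim: (trep t) => [|p s IHs]; first by rewrite !big_nil !lin0.
by rewrite !big_cons !linD // fg IHs.
Qed.

End Tensor.

Record dsum (R : comPzRingType) (I : Type) (M : I -> lmodType R) := Dsum {
  dval :> forall i, M i;
  dvalP : finite_set [set i | dval i <> 0] }.

Section DirectSum.
Context {R : comPzRingType} {I : Type} {M : I -> lmodType R}.

HB.instance Definition _ := gen_eqMixin (dsum M).
HB.instance Definition _ := gen_choiceMixin (dsum M).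

Lemma dsumP (a b : dsum M) : (forall i, a i = b i) -> a = b.
Proof.
case: a b => [f fP] [g gP] /= fg; have E : f = g by apply: functional_extensionality_dep.
by case: _ / E in gP *; congr Dsum; apply: Prop_irrelevance.
Qed.

Lemma dzero_subproof : finite_set [set i | (0 : M i) <> 0].
Proof. by apply: sub_finite_set (@finite_set0 I) => i /= /(_ erefl). Qed.

Definition dzero : dsum M := Dsum dzero_subproof.

Lemma dadd_subproof (a b : dsum M) : finite_set [set i | a i + b i <> 0].
Proof.
apply: sub_finite_set (_ : finite_set ([set i | a i <> 0] `|` [set i | b i <> 0])%classic).
  move=> i /= abi; apply: contrapT => /not_orP[/contrapT ai /contrapT bi].
  by apply: abi; rewrite ai bi addr0.
by rewrite finite_setU; split; apply: dvalP.
Qed.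

Definition dadd (a b : dsum M) : dsum M := Dsum (dadd_subproof a b).

Lemma dscale_subproof (r : R) (a : dsum M) : finite_set [set i | r *: a i <> 0].
Proof.
by apply: sub_finite_set (dvalP a) => i /= rai ai; apply: rai; rewrite ai scaler0.
Qed.

Definition dscale (r : R) (a : dsum M) : dsum M := Dsum (dscale_subproof r a).

Lemma daddA : associative dadd.
Proof. by move=> a b c; apply: dsumP => i /=; apply: addrA. Qed.

Lemma daddC : commutative dadd.
Proof. by move=> a b; apply: dsumP => i /=; apply: addrC. Qed.

Lemma dadd0 : left_id dzero dadd.
Proof. by move=> a; apply: dsumP => i /=; apply: add0r. Qed.

Lemma daddN : left_inverse dzero (dscale (- 1)) dadd.
Proof. by move=> a; apply: dsumP => i /=; rewrite scaleN1r addNr. Qed.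

HB.instance Definition _ := GRing.isZmodule.Build (dsum M) daddA daddC dadd0 daddN.

Lemma dscaleA r s a : dscale r (dscale s a) = dscale (r * s) a.
Proof. by apply: dsumP => i /=; apply: scalerA. Qed.

Lemma dscale1 : left_id 1 dscale.
Proof. by move=> a; apply: dsumP => i /=; apply: scale1r. Qed.

Lemma dscaleDr : right_distributive dscale +%R.
Proof. by move=> r a b; apply: dsumP => i /=; apply: scalerDr. Qed.

Lemma dscaleDl a : {morph dscale^~ a : r s / r + s}.
Proof. by move=> r s; apply: dsumP => i /=; apply: scalerDl. Qed.

HB.instance Definition _ :=
  GRing.Zmodule_isLmodule.Build R (dsum M) dscaleA dscale1 dscaleDr dscaleDl.

Lemma dval0 i : (0 : dsum M) i = 0.
Proof. by []. Qed.

Lemma dvalD (a b : dsum M) i : (a + b) i = a i + b i.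
Proof. by []. Qed.

Lemma dvalZ r (a : dsum M) i : (r *: a) i = r *: a i.
Proof. by []. Qed.

End DirectSum.

Lemma dinj_subproof (R : comPzRingType) (I : eqType) (M : I -> lmodType R)
    (i : I) (x : M i) :
  finite_set [set j | dfwith (fun j => 0 : M j) x j <> 0].
Proof.
apply: sub_finite_set (finite_set1 i) => j /=.
by case: (eqVneq i j) => [ij _|ij]; [exact: esym|]; rewrite dfwith_out.
Qed.

Definition dinj (R : comPzRingType) (I : eqType) (M : I -> lmodType R)
    (i : I) (x : M i) : dsum M :=
  Dsum (dinj_subproof x).

Definition img (R : comPzRingType) (M N : lmodType R) (f : {linear M -> N}) :
    {pred N} :=
  fun y => `[< exists x, y = f x >].

Record img_of (R : comPzRingType) (M N : lmodType R) (f : {linear M -> N}) :=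
  ImgOf { imgval :> N; imgvalP : imgval \in img f }.

Section Image.
Context {R : comPzRingType} {M N : lmodType R} (f : {linear M -> N}).

Lemma imgP y : reflect (exists x, y = f x) (y \in img f).
Proof. exact: asboolP. Qed.

Lemma img_submod_closed : subsemimod_closed (img f).
Proof.
split=> [|a y /imgP[x ->]]; last by apply/imgP; exists (a *: x); rewrite linearZ.
split; first by apply/imgP; exists 0; rewrite linear0.
by move=> y z /imgP[x ->] /imgP[x' ->]; apply/imgP; exists (x + x'); rewrite linearD.
Qed.

HB.instance Definition _ := GRing.isSubmodClosed.Build R N (img f) img_submod_closed.
HB.instance Definition _ := [isSub of img_of f for @imgval R M N f].
HB.instance Definition _ := [Choice of img_of f by <:].
HB.instance Definition _ := [SubChoice_isSubLmodule of img_of f by <:].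

End Image.

Record lincat (R : comPzRingType) := Lincat {
  hom : nat -> nat -> lmodType R;
  idm : forall n, hom n n;
  comp : forall l m n, hom m n -> hom l m -> hom l n;
  comp_linearl : forall l m n (g : hom l m), linear (fun f : hom m n => comp f g);
  comp_linearr : forall l m n (f : hom m n), linear (fun g : hom l m => comp f g);
  compA : forall k l m n (f : hom m n) (g : hom l m) (h : hom k l),
    comp f (comp g h) = comp (comp f g) h;
  compidl : forall m n (f : hom m n), comp (idm n) f = f;
  compidr : forall m n (f : hom m n), comp f (idm m) = f;
  hom_directed : forall m n, (n < m)%N -> forall f : hom m n, f = 0 }.

Arguments idm {R} C n : rename.
Arguments comp {R C l m n} f g : rename.

Section CompTheory.
Context {R : comPzRingType} {C : lincat R}.

Lemma compDl l m n (f f' : hom C m n) (g : hom C l m) :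
  comp (f + f') g = comp f g + comp f' g.
Proof. by have := comp_linearl g 1 f f'; rewrite !scale1r. Qed.

Lemma compDr l m n (f : hom C m n) (g g' : hom C l m) :
  comp f (g + g') = comp f g + comp f g'.
Proof. by have := comp_linearr f 1 g g'; rewrite !scale1r. Qed.

Lemma comp0l l m n (g : hom C l m) : comp (0 : hom C m n) g = 0.
Proof. by apply: (addrI (comp 0 g)); rewrite -compDl !addr0. Qed.

Lemma comp0r l m n (f : hom C m n) : comp f (0 : hom C l m) = 0.
Proof. by apply: (addrI (comp f 0)); rewrite -compDr !addr0. Qed.

Lemma compZl l m n a (f : hom C m n) (g : hom C l m) :
  comp (a *: f) g = a *: comp f g.
Proof. by have := comp_linearl g a f 0; rewrite comp0l !addr0. Qed.

Lemma compZr l m n a (f : hom C m n) (g : hom C l m) :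
  comp f (a *: g) = a *: comp f g.
Proof. by have := comp_linearr f a g 0; rewrite comp0r !addr0. Qed.

Lemma comp_suml l m n (J : Type) (s : seq J) (P : pred J) (F : J -> hom C m n)
    (g : hom C l m) :
  comp (\sum_(i <- s | P i) F i) g = \sum_(i <- s | P i) comp (F i) g.
Proof.
by elim/big_rec2: _ => [|i x y _ <-]; rewrite ?comp0l // compDl.
Qed.

Lemma comp_sumr l m n (J : Type) (s : seq J) (P : pred J) (F : J -> hom C l m)
    (f : hom C m n) :
  comp f (\sum_(i <- s | P i) F i) = \sum_(i <- s | P i) comp f (F i).
Proof.
by elim/big_rec2: _ => [|i x y _ <-]; rewrite ?comp0r // compDr.
Qed.

End CompTheory.

Section Tilde.
Context {R : comPzRingType} (C : lincat R).

(* The module laws of the [End(n)]-action are not part of the record; for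
   [tilde] below they are [eop_linear], [eop_linearl] and [eop_comp]. *)
Record endmod (n : nat) := Endmod {
  ecar :> lmodType R;
  eop : hom C n n -> ecar -> ecar }.

Definition hom_endmod (m n : nat) : endmod n := Endmod (@comp _ C m n n).

(* [Hom(n, n+1) (x)_{End(n)} T], on which [End(n+1)] acts on the left factor. *)
Definition tens_endmod (n : nat) (T : endmod n) : endmod n.+1 :=
  @Endmod n.+1 (tens (fun (f : hom C n n.+1) g => comp f g) (@eop n T))
    (fun g => tlift (fun f t => tpure _ _ (comp g f) t)).

(* [tilde m n] is [End(m)] for [n = m], [Hom(m,m+1)] for [n = m+1] and the
   iterated tensor product for [n >= m+2].  For [n < m] it is [Hom(m,n) = 0],
   which avoids any transport along equalities between [m] and [n]. *)
Fixpoint tilde (m n : nat) : endmod n :=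
  match n with
  | 0 => hom_endmod m 0
  | n'.+1 => if (n' <= m)%N then hom_endmod m n'.+1 else tens_endmod (tilde m n')
  end.

(* The functor to [C]; the map given to [tlift] is balanced, cf. [teval_balanced]. *)
Fixpoint teval (m n : nat) : tilde m n -> hom C m n :=
  match n return tilde m n -> hom C m n with
  | 0 => id
  | n'.+1 =>
    match (n' <= m)%N as b
      return (if b then hom_endmod m n'.+1 else tens_endmod (tilde m n')) ->
             hom C m n'.+1 with
    | true => id
    | false => tlift (fun f t => comp f (teval t))
    end
  end.

(* [f (x) t], to be read as the composition of [f] and [t] when [n <= m]. *)
Definition tcons (m n : nat) (f : hom C n n.+1) (t : tilde m n) : tilde m n.+1 :=
  match (n <= m)%N as b
    return (if b then hom_endmod m n.+1 else tens_endmod (tilde m n) : Type) with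
  | true => comp f (teval t)
  | false => tpure _ _ f t
  end.

Lemma tens_act_balanced n (T : endmod n) (g : hom C n.+1 n.+1) :
  balanced (fun (f : hom C n n.+1) h => comp f h) (@eop n T)
    (fun f t => tpure (fun (f : hom C n n.+1) h => comp f h) (@eop n T) (comp g f) t).
Proof.
have [pl pr pb] := tpure_balanced (fun (f : hom C n n.+1) h => comp f h) (@eop n T).
split=> [t a x y|x|x s t]; last by rewrite compA pb.
- by rewrite compDr compZr pl.
- exact: pr.
Qed.

Lemma teval_spec m n :
  linear (@teval m n) /\
  forall g (t : tilde m n), teval (eop g t) = comp g (teval t).
Proof.
elim: n => [|n [IHl IHe]] /=; first by split.
case: (n <= m)%N; first by split.
have B : balanced (fun (f : hom C n n.+1) h => comp f h) (@eop n (tilde m n))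
    (fun f t => comp f (teval t)).
  split=> [t a x y|x a t u|x s t]; first by rewrite compDl compZl.
  - by rewrite IHl compDr compZr.
  - by rewrite IHe compA.
have L := tlift_linear B; split=> // g t.
pose A := @tens_act_balanced n (tilde m n) g.
have LA := tlift_linear A.
move: t; apply: tens_ext => [a t u|a t u|f t].
- exact: etrans (congr1 _ (LA a t u)) (L _ _ _).
- by apply: etrans (congr1 _ (L a t u)) _; rewrite compDr compZr.
- by apply: etrans (congr1 _ (tlift_pure f t A)) _; rewrite !tlift_pure // compA.
Qed.

Lemma teval_linear m n : linear (@teval m n).
Proof. by case: (teval_spec m n). Qed.

Lemma teval_eop m n g (t : tilde m n) : teval (eop g t) = comp g (teval t).
Proof. by case: (teval_spec m n). Qed.

Lemma teval_balanced m n :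
  balanced (fun (f : hom C n n.+1) h => comp f h) (@eop n (tilde m n))
    (fun f t => comp f (teval t)).
Proof.
split=> [t a x y|x a t u|x s t]; first by rewrite compDl compZl.
- by rewrite teval_linear compDr compZr.
- by rewrite teval_eop compA.
Qed.

Lemma teval_tcons m n f (t : tilde m n) : teval (tcons f t) = comp f (teval t).
Proof.
rewrite /tcons /=; case: (n <= m)%N => //.
by rewrite tlift_pure //; apply: teval_balanced.
Qed.

Lemma tcons_balanced m n :
  balanced (fun (f : hom C n n.+1) h => comp f h) (@eop n (tilde m n))
    (@tcons m n).
Proof.
rewrite /tcons /=; case: (n <= m)%N; first exact: teval_balanced.
exact: tpure_balanced.
Qed.

Lemma eop_linear m n g : linear (@eop n (tilde m n) g).
Proof.
case: n g => [|n] /= g; first exact: comp_linearr.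
case: (n <= m)%N; first exact: comp_linearr.
exact/tlift_linear/tens_act_balanced.
Qed.

Lemma eop_linearl m n t : linear (fun g => @eop n (tilde m n) g t).
Proof.
case: n t => [|n] /= t; first exact: comp_linearl.
case: (n <= m)%N t => /= t; first exact: comp_linearl.
move=> a g g'; move: t; apply: tens_ext => [b t u|b t u|f t].
- exact/tlift_linear/tens_act_balanced.
- have LA h := tlift_linear (tens_act_balanced (tilde m n) h) b t u.
  apply: etrans (congr2 (fun x y => a *: x + y) (LA g) (LA g')) _.
  by rewrite !scalerDr !scalerA (mulrC a) addrACA.
rewrite !tlift_pure //; try exact: tens_act_balanced.
by rewrite compDl compZl; case: (tpure_balanced (fun (f : hom C n n.+1) h => comp f h) (@eop n (tilde m n))) => ->.
Qed.

Lemma eop_comp m n g h (t : tilde m n) : eop g (eop h t) = eop (comp g h) t.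
Proof.
case: n g h t => [|n] /= g h t; first by rewrite compA.
case: (n <= m)%N t => /= t; first by rewrite compA.
move: t; apply: tens_ext => [b t u|b t u|f t].
- have LA k := tlift_linear (tens_act_balanced (tilde m n) k).
  exact: etrans (congr1 _ (LA h b t u)) (LA g _ _ _).
- exact/tlift_linear/tens_act_balanced.
have E k u := tlift_pure u t (tens_act_balanced (tilde m n) k).
by apply: etrans (congr1 _ (E h f)) _; rewrite [LHS]E [RHS]E compA.
Qed.

Lemma eop_tcons m n g f (t : tilde m n) : eop g (tcons f t) = tcons (comp g f) t.
Proof.
rewrite /tcons /=; case: (n <= m)%N => /=; first by rewrite compA.
by rewrite tlift_pure //; exact: tens_act_balanced.
Qed.

(* Extends [rec : s |-> s t] to [f (x) s |-> f (x) (s t)]. *)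
Definition tcat_step (l m n : nat) (rec : tilde m n -> tilde l n) :
    tilde m n.+1 -> tilde l n.+1 :=
  match (n <= m)%N as b
    return (if b then hom_endmod m n.+1 else tens_endmod (tilde m n)) ->
           tilde l n.+1 with
  | true => fun=> 0
  | false => tlift (fun f s => tcons f (rec s))
  end.

(* Concatenation [s t], by recursion on the length [k] of the left factor [s]. *)
Fixpoint tcat (l m k : nat) (t : tilde l m) : tilde m (k + m) -> tilde l (k + m) :=
  match k return tilde m (k + m) -> tilde l (k + m) with
  | 0 => fun s => eop (teval s) t
  | k1.+1 =>
    match k1 return (tilde m (k1 + m) -> tilde l (k1 + m)) ->
                    tilde m (k1.+1 + m) -> tilde l (k1.+1 + m) with
    | 0 => fun _ s => tcons (teval s) t
    | k2.+1 => fun rec => tcat_step rec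
    end (@tcat l m k1 t)
  end.

Lemma tcat_step_spec l m n (rec : tilde m n -> tilde l n) : (m < n)%N ->
  linear rec -> (forall g s, rec (eop g s) = eop g (rec s)) ->
  [/\ linear (tcat_step rec),
      forall g s, tcat_step rec (eop g s) = eop g (tcat_step rec s)
    & forall f s, tcat_step rec (tcons f s) = tcons f (rec s)].
Proof.
move=> mn rl re; rewrite /tcat_step.
set c := @tcons l n; rewrite /tcons /= {}/c.
case: (leqP n m) mn => [_ //|_ _] /=.
have B : balanced (fun (f : hom C n n.+1) h => comp f h) (@eop n (tilde m n))
    (fun f s => tcons f (rec s)).
  have [tl tr tb] := @tcons_balanced l n.
  split=> [s a x y|f a x y|f g s]; first exact: tl.
  - by rewrite rl tr.
  - by rewrite re tb.
have L := tlift_linear B; split=> [//|g s|f s]; last exact: tlift_pure.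
have A := tens_act_balanced (tilde m n) g; have LA := tlift_linear A.
move: s; apply: tens_ext => [a t u|a t u|f t].
- exact: etrans (congr1 _ (LA a t u)) (L _ _ _).
- by apply: etrans (congr1 _ (L a t u)) _; rewrite (@eop_linear l n.+1 g).
- apply: etrans (congr1 _ (tlift_pure f t A)) _.
  by rewrite !tlift_pure // eop_tcons.
Qed.

Lemma tcat_spec l m k (t : tilde l m) :
  linear (tcat (k := k) t) /\
  forall g (s : tilde m (k + m)), tcat t (eop g s) = eop g (tcat t s).
Proof.
elim: k => [|[|k] [IHl IHe]].
- split=> [a x y|g s].
  + exact: etrans (congr1 (fun f => eop f t) (@teval_linear m m a x y))
                  (eop_linearl _ _ _ _).
  + apply: etrans (congr1 (fun f => eop f t) (@teval_eop m m g s)) _.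
    exact: esym (eop_comp _ _ _).
- have [tl _ _] := @tcons_balanced l m; split=> [a x y|g s].
  + exact: etrans (congr1 (fun f => tcons f t) (@teval_linear m m.+1 a x y))
                  (tl _ _ _ _).
  + apply: etrans (congr1 (fun f => tcons f t) (@teval_eop m m.+1 g s)) _.
    exact: esym (@eop_tcons l m g _ t).
have mk : (m < k.+1 + m)%N by rewrite addSn ltnS leq_addl.
by have [] := tcat_step_spec mk IHl IHe.
Qed.

Lemma tcat0 l m (t : tilde l m) s : tcat (k := 0) t s = eop (teval s) t.
Proof. by []. Qed.

Lemma tcat1 l m (t : tilde l m) s : tcat (k := 1) t s = tcons (teval s) t.
Proof. by []. Qed.

Lemma tcat_tcons l m k (t : tilde l m) (f : hom C (k + m) (k + m).+1) s :
  tcat (k := k.+1) t (tcons f s) = tcons f (tcat (k := k) t s).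
Proof.
case: k f s => [|k] f s.
  have [_ _ tb] := @tcons_balanced l m; rewrite tcat0 -tb tcat1.
  by congr tcons; apply: teval_tcons.
have mk : (m < k.+1 + m)%N by rewrite addSn ltnS leq_addl.
have [L E] := @tcat_spec l m k.+1 t.
by have [_ _] := tcat_step_spec mk L E; apply.
Qed.

Lemma tcons_span m n (t : tilde m n.+1) : (m < n)%N ->
  exists s : seq (hom C n n.+1 * tilde m n), t = \sum_(p <- s) tcons p.1 p.2.
Proof.
move: t; rewrite /tcons /=; case: (leqP n m) => //= _ t _.
by exists (trep t); apply: tensE.
Qed.

Lemma teval_tcat l m k (t : tilde l m) (s : tilde m (k + m)) :
  teval (tcat t s) = comp (teval s) (teval t).
Proof.
elim: k s => [|[|k] IHk] s; first exact: teval_eop.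
  exact: teval_tcons.
have mk : (m < k.+1 + m)%N by rewrite addSn ltnS leq_addl.
have [ss ->] := @tcons_span m (k.+1 + m) s mk.
have [L _] := @tcat_spec l m k.+2 t.
rewrite (linear_sumE L) !(linear_sumE (@teval_linear _ _)) comp_suml.
apply: eq_bigr => p _.
by rewrite tcat_tcons teval_tcons IHk [in RHS](@teval_tcons m) compA.
Qed.

(* Composition by concatenation; it is [0] for [n < m], where [tilde m n = 0]. *)
Definition tcomp (l m n : nat) (s : tilde m n) (t : tilde l m) : tilde l n :=
  if @idP (m <= n)%N is ReflectT mn then
    ecast i (tilde l i) (subnK mn)
      (tcat t (ecast i (tilde m i) (esym (subnK mn)) s))
  else 0.

Lemma tcomp_tcat l m k (s : tilde m (k + m)) (t : tilde l m) :
  tcomp s t = tcat t s.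
Proof.
rewrite /tcomp; case: {-}_ / idP => [mn|]; last by rewrite leq_addl.
have E : (k + m - m)%N = k by rewrite addnK.
move: (subnK mn); rewrite E => e.
by rewrite !eq_axiomK.
Qed.

Lemma teval_tcomp l m n (s : tilde m n) (t : tilde l m) : (m <= n)%N ->
  teval (tcomp s t) = comp (teval s) (teval t).
Proof.
move=> mn; rewrite -(subnK mn) in s *.
by rewrite tcomp_tcat teval_tcat.
Qed.

Definition in_relations (m n : nat) (t : tilde m n) : Prop := teval t = 0.

(* The image in [tilde m n] of
   [tilde (r+d) n (x) I(r,r+d) (x) tilde m r]. *)
Definition relations_from (d r m n : nat) (t : tilde m n) : Prop :=
  exists s : seq (tilde (r + d) n * tilde r (r + d) * tilde m r),
    (forall p, p \in s -> in_relations p.1.2) /\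
    t = \sum_(p <- s) tcomp p.1.1 (tcomp p.1.2 p.2).

Definition relations_generated (d : nat) : Prop :=
  (forall m n, (m + 2 <= n)%N -> forall f : hom C m n, exists t : tilde m n, teval t = f) /\
  (forall m n, (m + d <= n)%N -> forall t : tilde m n,
    in_relations t <->
    exists u : nat -> tilde m n,
      (forall r, (m <= r <= n - d)%N -> relations_from d r (u r)) /\
      t = \sum_(m <= r < (n - d).+1) u r).

End Tilde.

Section CategoryAlgebra.
Context {R : comPzRingType} (C : lincat R).

Definition catalg := dsum (fun p : nat * nat => hom C p.1 p.2).
HB.instance Definition _ := GRing.Lmodule.on catalg.

Implicit Types a b c : catalg.

Definition entry a m n : hom C m n := a (m, n).

(* The terms with [p.2 < k] would vanish, as [Hom(k, p.2) = 0]. *)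
Definition amul_entry a b (p : nat * nat) : hom C p.1 p.2 :=
  \sum_(0 <= k < p.2.+1) comp (entry a k p.2) (entry b p.1 k).

Lemma amul_subproof a b : finite_set [set p | amul_entry a b p <> 0].
Proof.
pose f (x : (nat * nat) * (nat * nat)) := (x.2.1, x.1.2).
have fin : finite_set (f @` ([set p | a p <> 0] `*` [set p | b p <> 0]))%classic.
  by apply: finite_image; apply: finite_setX; apply: dvalP.
apply: sub_finite_set fin => -[m n] /= abmn; apply: contrapT => nex; apply: abmn.
rewrite /amul_entry /= big1 // => k _.
have [->|akn] := pselect (entry a k n = 0); first exact: comp0l.
have [->|bmk] := pselect (entry b m k = 0); first exact: comp0r.
by exfalso; apply: nex; exists ((k, n), (m, k)).
Qed.

Definition amul a b : catalg := Dsum (amul_subproof a b).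

Lemma amul_linearl b : linear (amul^~ b).
Proof.
move=> r a a'; apply: dsumP => p.
rewrite dvalD dvalZ /= /amul_entry scaler_sumr -big_split /=.
by apply: eq_bigr => k _; rewrite -compZl -compDl.
Qed.

Lemma amul_linearr a : linear (amul a).
Proof.
move=> r b b'; apply: dsumP => p.
rewrite dvalD dvalZ /= /amul_entry scaler_sumr -big_split /=.
by apply: eq_bigr => k _; rewrite -compZr -compDr.
Qed.

Lemma amulA a b c : amul a (amul b c) = amul (amul a b) c.
Proof.
apply: dsumP => -[m n] /=; rewrite /amul_entry /=.
under eq_big_nat => k /andP[_ kn].
  rewrite /= /amul_entry /= comp_sumr.
  under eq_bigr do rewrite compA.
  rewrite (big_nat_widen _ _ n.+1) //=.
  over.
under [in RHS]eq_bigr do rewrite /amul_entry /= comp_suml.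
rewrite [RHS]exchange_big_nat /=; apply: eq_bigr => k _.
rewrite big_mkcond /=; apply: eq_bigr => j _; case: ifPn => //.
by rewrite -leqNgt => kj; rewrite (@hom_directed _ C j k _ (entry b j k)) ?comp0r ?comp0l.
Qed.

Definition eid (n : nat) : catalg :=
  @dinj R (nat * nat)%type (fun p => hom C p.1 p.2) (n, n) (idm C n).

(* [e_{m,n}] *)
Definition eint (m n : nat) : catalg := \sum_(m <= k < n.+1) eid k.

Definition amulr b : catalg -> catalg := amul^~ b.
Definition acorner e : catalg -> catalg := fun a => amul e (amul a e).

HB.instance Definition _ b :=
  GRing.isLinear.Build R catalg catalg _ (amulr b) (amul_linearl b).

Lemma acorner_linear e : linear (acorner e).
Proof. by move=> r a b; rewrite /acorner amul_linearl amul_linearr. Qed.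

HB.instance Definition _ e :=
  GRing.isLinear.Build R catalg catalg _ (acorner e) (acorner_linear e).

Record amod := Amod {
  acar :> lmodType R;
  aact : catalg -> {linear acar -> acar};
  aact_linearl : forall v, linear (fun a => aact a v);
  aactM : forall a b v, aact (amul a b) v = aact a (aact b v) }.

Definition amod_hom (V W : amod) (f : V -> W) : Prop :=
  linear f /\ forall a v, f (aact V a v) = aact W a (f v).

Definition exact_at (U V W : amod) (f : U -> V) (g : V -> W) : Prop :=
  forall v, g v = 0 <-> exists u, f u = v.

Section LeftIdeal.
Variable e : catalg.

Definition Ae : lmodType R := img_of (amulr e).

Lemma Ae_act_subproof a (x : Ae) : amul a (imgval x) \in img (amulr e).
Proof.
case: x => x /= /imgP[b ->]; apply/imgP; exists (amul a b).
by rewrite /amulr amulA.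
Qed.

Definition Ae_act a (x : Ae) : Ae := ImgOf (Ae_act_subproof a x).

Lemma Ae_act_linear a : linear (Ae_act a).
Proof. by move=> r x y; apply: val_inj; apply: amul_linearr. Qed.

HB.instance Definition _ a :=
  GRing.isLinear.Build R Ae Ae _ (Ae_act a) (Ae_act_linear a).

Lemma Ae_act_linearl (x : Ae) : linear (Ae_act^~ x).
Proof. by move=> r a b; apply: val_inj; apply: amul_linearl. Qed.

Lemma Ae_actM a b (x : Ae) : Ae_act (amul a b) x = Ae_act a (Ae_act b x).
Proof. by apply: val_inj; rewrite /= amulA. Qed.

Definition Ae_mod : amod := @Amod Ae (fun a => Ae_act a) Ae_act_linearl Ae_actM.

End LeftIdeal.

Section DirectSumModule.
Variables (I : Type) (V : I -> amod).

Let D : lmodType R := dsum (fun i => acar (V i)).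

Lemma dsum_act_subproof a (x : D) : finite_set [set i | aact (V i) a (x i) <> 0].
Proof.
by apply: sub_finite_set (dvalP x) => i /= axi xi; apply: axi; rewrite xi linear0.
Qed.

Definition dsum_act a (x : D) : D := Dsum (dsum_act_subproof a x).

Lemma dsum_act_linear a : linear (dsum_act a).
Proof. by move=> r x y; apply: dsumP => i /=; rewrite linearP. Qed.

HB.instance Definition _ a :=
  GRing.isLinear.Build R D D _ (dsum_act a) (dsum_act_linear a).

Lemma dsum_act_linearl (x : D) : linear (dsum_act^~ x).
Proof. by move=> r a b; apply: dsumP => i /=; apply: aact_linearl. Qed.

Lemma dsum_actM a b (x : D) : dsum_act (amul a b) x = dsum_act a (dsum_act b x).
Proof. by apply: dsumP => i /=; apply: aactM. Qed.

Definition dsum_mod : amod :=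
  @Amod D (fun a => dsum_act a) dsum_act_linearl dsum_actM.

End DirectSumModule.

Section Induced.
Variables (e : catalg) (V : amod).

Definition eAe : lmodType R := img_of (acorner e).
Definition eV : lmodType R := img_of (aact V e).

Lemma Ae_eAe_subproof (x : Ae e) (s : eAe) :
  amul (imgval x) (imgval s) \in img (amulr e).
Proof.
case: s => s /= /imgP[b ->]; apply/imgP.
by exists (amul (imgval x) (amul e b)); rewrite /amulr /acorner !amulA.
Qed.

Definition Ae_eAe (x : Ae e) (s : eAe) : Ae e := ImgOf (Ae_eAe_subproof x s).

Lemma eAe_eV_subproof (s : eAe) (v : eV) :
  aact V (imgval s) (imgval v) \in img (aact V e).
Proof.
case: s => s /= /imgP[b ->]; apply/imgP.
by exists (aact V (amul b e) (imgval v)); rewrite -aactM.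
Qed.

Definition eAe_eV (s : eAe) (v : eV) : eV := ImgOf (eAe_eV_subproof s v).

Definition AeeV : lmodType R := tens Ae_eAe eAe_eV.

Lemma AeeV_balanced a :
  balanced Ae_eAe eAe_eV (fun x v => tpure Ae_eAe eAe_eV (Ae_act a x) v).
Proof.
have [pl pr pb] := tpure_balanced Ae_eAe eAe_eV.
split=> [v r x y|x|x s v]; [by rewrite linearP pl|exact: pr|].
by rewrite -pb; congr tpure; apply: val_inj => /=; rewrite amulA.
Qed.

Definition AeeV_act a : AeeV -> AeeV :=
  tlift (fun x v => tpure Ae_eAe eAe_eV (Ae_act a x) v).

HB.instance Definition _ a :=
  GRing.isLinear.Build R AeeV AeeV _ (AeeV_act a) (tlift_linear (AeeV_balanced a)).

Lemma AeeV_act_linearl t : linear (AeeV_act^~ t).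
Proof.
move=> r a b; move: t; apply: tens_ext => [s t u|s t u|x v].
- exact: (linearP (AeeV_act (r *: a + b))).
- rewrite (linearP (AeeV_act a)) (linearP (AeeV_act b)) !scalerDr !scalerA (mulrC r).
  by rewrite addrACA.
rewrite /AeeV_act !(tlift_pure _ _ (AeeV_balanced _)) Ae_act_linearl.
by have [pl _ _] := tpure_balanced Ae_eAe eAe_eV; apply: pl.
Qed.

Lemma AeeV_actM a b t : AeeV_act (amul a b) t = AeeV_act a (AeeV_act b t).
Proof.
move: t; apply: tens_ext => [s t u|s t u|x v].
- exact: (linearP (AeeV_act (amul a b))).
- by rewrite (linearP (AeeV_act b)) (linearP (AeeV_act a)).
by rewrite /AeeV_act !(tlift_pure _ _ (AeeV_balanced _)) Ae_actM.
Qed.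

Definition AeeV_mod : amod :=
  @Amod AeeV (fun a => AeeV_act a) AeeV_act_linearl AeeV_actM.

End Induced.

(* [V] is the internal direct sum of the [e_n V]. *)
Definition graded (V : amod) : Prop :=
  (forall v : V, exists (N : nat) (w : nat -> V),
     (forall n, w n \in img (aact V (eid n))) /\ v = \sum_(0 <= n < N) w n) /\
  (forall (N : nat) (w : nat -> V),
     (forall n, w n \in img (aact V (eid n))) -> \sum_(0 <= n < N) w n = 0 ->
     forall n, (n < N)%N -> w n = 0).

Definition presented_in_finite_degrees (V : amod) : Prop :=
  exists (N : nat) (I J : Type),
    let F (K : Type) := dsum_mod (fun _ : K => Ae_mod (eint 0 N)) in
    exists (f : F J -> F I) (g : F I -> V),
      [/\ amod_hom f, amod_hom g, exact_at f g & forall v, exists x, g x = v].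

(* The submodule [(+)_{n >= k} e_n V]. *)
Definition tail (V : amod) (k : nat) (v : V) : Prop :=
  exists (N : nat) (w : nat -> V),
    (forall n, w n \in img (aact V (eid n))) /\ v = \sum_(k <= n < N) w n.

(* The isomorphism is rendered as an injective homomorphism to [V] with image
   the submodule on the right-hand side. *)
Definition centrally_stable (d : nat) (V : amod) : Prop :=
  exists N0 : nat, forall N : nat, (N0 <= N)%N ->
    exists phi : AeeV_mod (eint (N - (d - 1)) N) V -> V,
      [/\ amod_hom phi, injective phi
        & forall v, tail (N - (d - 1)) v <-> exists t, phi t = v].

End CategoryAlgebra.

(* Main.v *)
Require Import Defs.
From mathcomp Require Import all_boot all_order all_algebra.
From mathcomp Require Import boolp classical_sets functions cardinality.
From mathcomp Require Import zify.

Set Implicit Arguments.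
Unset Strict Implicit.
Unset Printing Implicit Defensive.

Import GRing.Theory Defs.
Local Open Scope ring_scope.

(* Put [a = N - (d-1)], [e = e_{a,N}], [T W = Ae (x)_{eAe} eW], and let
   [counit : T W -> W] be the multiplication map; take [N] so large that [a]
   exceeds the bound [K] on the degrees in the presentation.  An element [y] of
   [W] and a degree [m < a] give maps [Hom(m,n) -> T W] for [n >= a], which lift
   [h |-> h y] along [counit]: on the tensor category send [t] to [e_n (x) t y]
   if [n <= N], and [f (x) t] to [f] times the image of [t] beyond.  Each
   generating relation of length [d] either ends in degree [<= N] or starts in
   degree [>= a]; in both cases it is sent to [0], so the map factors through
   [Hom(m,n)].  Applied to the generators of [P = (+) Ae_{0,K}], these maps invert
   [counit] onto the tail of [P], and a diagram chase in the presentation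
   transfers this to [V]. *)

(** * Direct sums and the category algebra *)

Section Linear.
Variables (R : pzRingType) (U V : lmodType R) (f : U -> V).
Hypothesis fl : linear f.

Lemma lin0 : f 0 = 0.
Proof. by have := fl (-1) 0 0; rewrite scaler0 add0r scaleN1r addNr. Qed.

Lemma linD x y : f (x + y) = f x + f y.
Proof. by have := fl 1 x y; rewrite !scale1r. Qed.

End Linear.

Section Dinj.
Context {R : comPzRingType} {I : eqType} {M : I -> lmodType R}.

Lemma dinjE (i : I) (x : M i) : dinj x i = x.
Proof. exact: dfwith_in. Qed.

Lemma dinj_out (i j : I) (x : M i) : i != j -> dinj x j = 0.
Proof. exact: dfwith_out. Qed.

Lemma dinj_linear i : linear (@dinj R I M i).
Proof.
move=> a x y; apply: dsumP => j; rewrite dvalD dvalZ.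
have [ij|ij] := eqVneq i j; first by case: _ / ij; rewrite !dinjE.
by rewrite !dinj_out // scaler0 addr0.
Qed.

Lemma dval_sum (J : Type) (s : seq J) (F : J -> dsum M) i :
  (\sum_(j <- s) F j) i = \sum_(j <- s) F j i.
Proof. by elim/big_rec2: _ => // j x y _ <-. Qed.

(** Allowing every duplicate-free list that contains the support makes it possible to expand several
    elements over one common list. *)
Lemma dsum_decomp (x : dsum M) : exists L : seq I,
  forall L', uniq L' -> {subset L <= L'} -> x = \sum_(i <- L') dinj (x i).
Proof.
have /finite_seqP[L EL] := dvalP x.
exists L => L' uL' sL; apply: dsumP => i; rewrite dval_sum.
have x0 j : j \notin L -> x j = 0.
  move=> jL; apply: contrapT => xj; have : [set` L]%classic j by rewrite -EL.
  by rewrite /= (negPf jL).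
have [iL|iL] := boolP (i \in L').
  rewrite (bigD1_seq i) // dinjE big1_seq /= ?addr0 // => j /andP[ji _].
  exact: dinj_out.
rewrite x0; last by apply: contra iL => /sL.
rewrite big1_seq // => j /andP[_ jL].
by apply: dinj_out; apply: contraNneq iL => <-.
Qed.

End Dinj.

(** * Morphisms as elements of the category algebra *)

Section Morphisms.
Context {R : comPzRingType} {C : lincat R}.
Implicit Types a b : catalg C.

Local Arguments entry : simpl never.

Definition mor m n (f : hom C m n) : catalg C :=
  @dinj R (nat * nat)%type (fun p => hom C p.1 p.2) (m, n) f.

Lemma morE m n (f : hom C m n) : entry (mor f) m n = f.
Proof. exact: (@dinjE R (nat * nat)%type (fun p => hom C p.1 p.2) (m, n)). Qed.

Lemma mor_out m n (f : hom C m n) i j : (m, n) != (i, j) -> entry (mor f) i j = 0.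
Proof. exact: (@dinj_out R (nat * nat)%type (fun p => hom C p.1 p.2)). Qed.

Lemma mor_linear m n : linear (@mor m n).
Proof.
exact: (@dinj_linear R (nat * nat)%type (fun p => hom C p.1 p.2) (m, n)).
Qed.

Lemma eidE n : eid C n = mor (idm C n).
Proof. by []. Qed.

Lemma catalgP a b : (forall m n, entry a m n = entry b m n) -> a = b.
Proof. by move=> ab; apply: dsumP => -[m n]; apply: ab. Qed.

Lemma entry_sum (J : Type) (s : seq J) (F : J -> catalg C) m n :
  entry (\sum_(j <- s) F j) m n = \sum_(j <- s) entry (F j) m n.
Proof. by elim/big_rec2: _ => // j x y _ <-. Qed.

Lemma entry_amul a b m n :
  entry (amul a b) m n = \sum_(0 <= k < n.+1) comp (entry a k n) (entry b m k).
Proof. by []. Qed.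

Lemma entry_eidl k a m n :
  entry (amul (eid C k) a) m n = if n == k then entry a m n else 0.
Proof.
rewrite entry_amul eidE; case: eqP => [<-|/eqP nk]; last first.
  by rewrite big1 // => i _; rewrite mor_out ?comp0l // xpair_eqE andbC eq_sym (negPf nk).
rewrite big_nat_recr //= big_nat big1 ?add0r => [|i /andP[_ ilt]].
  by rewrite morE compidl.
by rewrite mor_out ?comp0l // xpair_eqE (gtn_eqF ilt).
Qed.

Lemma entry_eidr k a m n :
  entry (amul a (eid C k)) m n = if m == k then entry a m n else 0.
Proof.
rewrite entry_amul eidE; case: eqP => [<-|/eqP mk]; last first.
  by rewrite big1 // => i _; rewrite mor_out ?comp0r // xpair_eqE eq_sym (negPf mk).
(* The sum defining the product stops at [n], so the index [m] occurs in it only if [m <= n];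
   otherwise directedness makes both sides [0]. *)
have [nm|mn] := ltnP n m.
  by rewrite [RHS](hom_directed nm) big1 // => i _; apply: (hom_directed nm).
rewrite (bigD1_seq m) ?iota_uniq ?mem_index_iota //= morE compidr big1 ?addr0 // => i im.
by rewrite mor_out ?comp0r // xpair_eqE eqxx eq_sym.
Qed.

Lemma entry_eintl k l a m n :
  entry (amul (eint C k l) a) m n = if (k <= n <= l)%N then entry a m n else 0.
Proof.
rewrite /eint (linear_sumE (amul_linearl a)) entry_sum.
under eq_bigr do rewrite entry_eidl.
case: ifP => kl.
  rewrite (bigD1_seq n) ?iota_uniq ?mem_index_iota //= eqxx.
  by rewrite big1 ?addr0 // => i /negPf; rewrite eq_sym => ->.
rewrite big_nat big1 // => i /andP[ki il].
by case: eqP => // ni; rewrite ni ki -ltnS il in kl.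
Qed.

Lemma entry_eintr k l a m n :
  entry (amul a (eint C k l)) m n = if (k <= m <= l)%N then entry a m n else 0.
Proof.
rewrite /eint (linear_sumE (amul_linearr a)) entry_sum.
under eq_bigr do rewrite entry_eidr.
case: ifP => kl.
  rewrite (bigD1_seq m) ?iota_uniq ?mem_index_iota //= eqxx.
  by rewrite big1 ?addr0 // => i /negPf; rewrite eq_sym => ->.
rewrite big_nat big1 // => i /andP[ki il].
by case: eqP => // ni; rewrite ni ki -ltnS il in kl.
Qed.

Lemma mor_entry a m n : mor (entry a m n) = amul (eid C n) (amul a (eid C m)).
Proof.
apply: catalgP => i j; rewrite entry_eidl entry_eidr.
have [->|jn] := eqVneq j n; last by rewrite mor_out // xpair_eqE andbC eq_sym (negPf jn).
have [->|im] := eqVneq i m; first by rewrite morE.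
by rewrite mor_out // xpair_eqE eq_sym (negPf im).
Qed.

Lemma amul_eidl m n (f : hom C m n) : amul (eid C n) (mor f) = mor f.
Proof.
apply: catalgP => i j; rewrite entry_eidl; case: eqP => // /eqP jn.
by rewrite mor_out // xpair_eqE andbC eq_sym (negPf jn).
Qed.

Lemma amul_eidr m n (f : hom C m n) : amul (mor f) (eid C m) = mor f.
Proof.
apply: catalgP => i j; rewrite entry_eidr; case: eqP => // /eqP im.
by rewrite mor_out // xpair_eqE eq_sym (negPf im).
Qed.

(** The product lies in [e_n A e_l], so by [mor_entry] only its entry at [(l, n)] has to be
    computed. *)
Lemma amul_mor l m n (f : hom C m n) (g : hom C l m) :
  amul (mor f) (mor g) = mor (comp f g).
Proof.
rewrite -(amul_eidl f) -(amul_eidr g) -amulA [amul (mor f) _]amulA -mor_entry.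
congr mor; have [nm|mn] := ltnP n m.
  by rewrite (hom_directed nm f) comp0l (lin0 (@mor_linear m n)) (lin0 (amul_linearl _)).
rewrite entry_amul (bigD1_seq m) ?iota_uniq ?mem_index_iota //= !morE.
by rewrite big1 ?addr0 // => i im; rewrite mor_out ?comp0l // xpair_eqE eq_sym (negPf im).
Qed.

Lemma amul_eintl k l m n (f : hom C m n) : (k <= n <= l)%N ->
  amul (eint C k l) (mor f) = mor f.
Proof.
move=> kl; apply: catalgP => i j; rewrite entry_eintl; case: ifP => // kj.
rewrite mor_out // xpair_eqE andbC; case: eqP => // nj.
by rewrite nj kj in kl.
Qed.

Lemma amul_eintr k l m n (f : hom C m n) : (k <= m <= l)%N ->
  amul (mor f) (eint C k l) = mor f.
Proof.
move=> kl; apply: catalgP => i j; rewrite entry_eintr; case: ifP => // kj.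
by rewrite mor_out // xpair_eqE; case: eqP => // ni; rewrite ni kj in kl.
Qed.

Lemma eint_idem k l : amul (eint C k l) (eint C k l) = eint C k l.
Proof.
rewrite {2 3}/eint (linear_sumE (amul_linearr _)) !big_nat.
by apply: eq_bigr => i ?; rewrite eidE amul_eintl.
Qed.

Lemma catalg_bounded a : exists M, forall m n, (M < n)%N -> entry a m n = 0.
Proof.
have /finite_seqP[L EL] := dvalP a.
exists (\max_(p <- L) p.2)%N => m n Mn; apply: contrapT => amn.
have /= nL : [set` L]%classic (m, n) by rewrite -EL.
by have := @leq_bigmax_seq _ L xpredT snd (m, n) nL isT; rewrite /= leqNgt Mn.
Qed.

End Morphisms.

(** * Induced modules *)

Section Modules.
Context {R : comPzRingType} {C : lincat R}.
Implicit Types (a b e : catalg C) (U V W : amod C).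

Lemma aact_suml V (J : Type) (s : seq J) (F : J -> catalg C) (v : V) :
  aact V (\sum_(i <- s) F i) v = \sum_(i <- s) aact V (F i) v.
Proof. exact: (linear_sumE (aact_linearl v)). Qed.

Lemma in_Ae e a : amul a e \in img (amulr e).
Proof. by apply/imgP; exists a. Qed.

Lemma in_eV e V (v : V) : aact V e v \in img (aact V e).
Proof. by apply/imgP; exists v. Qed.

(* The class of [ae (x) ev], for arbitrary [a] in [A] and [v] in [V]. *)
Definition ptens e V a (v : V) : AeeV e V :=
  tpure _ _ (ImgOf (in_Ae e a)) (ImgOf (in_eV e v)).

Lemma ptens_linearl e V (v : V) : linear (fun a => ptens e a v).
Proof.
have [pl _ _] := tpure_balanced (@Ae_eAe _ _ e) (@eAe_eV _ _ e V).
move=> r a b; rewrite /ptens -pl; congr tpure; apply: val_inj.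
exact: amul_linearl.
Qed.

Lemma ptens_linearr e V a : linear (@ptens e V a).
Proof.
have [_ pr _] := tpure_balanced (@Ae_eAe _ _ e) (@eAe_eV _ _ e V).
move=> r v w; rewrite /ptens -pr; congr tpure; apply: val_inj.
exact: linearP.
Qed.

Lemma ptens_actE e V a b (v : V) : AeeV_act b (ptens e a v) = ptens e (amul b a) v.
Proof.
rewrite /AeeV_act tlift_pure; last exact: AeeV_balanced.
by congr tpure; apply: val_inj; rewrite /= amulA.
Qed.

Lemma AeeV_act_linear e V a : linear (@AeeV_act _ _ e V a).
Proof. by move=> r t u; apply: tlift_linear; apply: AeeV_balanced. Qed.

Section Counit.
Variables (e : catalg C) (V : amod C).

Lemma counit_balanced :
  balanced (@Ae_eAe _ _ e) (@eAe_eV _ _ e V)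
    (fun x v => aact V (imgval x) (imgval v)).
Proof.
split=> [v r x y|x r v w|x s v].
- exact: aact_linearl.
- exact: linearP.
- by rewrite /= aactM.
Qed.

Definition counit : AeeV e V -> V :=
  tlift (fun x v => aact V (imgval x) (imgval v)).

Lemma counit_linear : linear counit.
Proof. exact: tlift_linear counit_balanced. Qed.

Lemma counit_act a t : counit (AeeV_act a t) = aact V a (counit t).
Proof.
move: t; apply: tens_ext => [r t u|r t u|x v].
- by rewrite AeeV_act_linear counit_linear.
- by rewrite counit_linear linearP.
rewrite /AeeV_act (tlift_pure _ _ (AeeV_balanced _ _ _)).
by rewrite /counit !(tlift_pure _ _ counit_balanced) /= aactM.
Qed.

End Counit.

Section Map.
Variables (e : catalg C) (V W : amod C) (f : V -> W).
Hypothesis hf : amod_hom f.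

Lemma eV_map_subproof (v : eV e V) : f (imgval v) \in img (aact W e).
Proof.
case: v => v /= /imgP[w ->]; apply/imgP; exists (f w).
by case: hf => _ ->.
Qed.

Definition eV_map (v : eV e V) : eV e W := ImgOf (eV_map_subproof v).

Lemma AeeV_map_balanced :
  balanced (@Ae_eAe _ _ e) (@eAe_eV _ _ e V)
    (fun x v => tpure (@Ae_eAe _ _ e) (@eAe_eV _ _ e W) x (eV_map v)).
Proof.
have [pl pr pb] := tpure_balanced (@Ae_eAe _ _ e) (@eAe_eV _ _ e W).
split=> [v|x r v w|x s v]; first exact: pl.
- by rewrite -pr; congr tpure; apply: val_inj; case: hf => fl _; apply: fl.
- by rewrite pb; congr tpure; apply: val_inj; case: hf => _ fa; rewrite /= fa.
Qed.

Definition AeeV_map : AeeV e V -> AeeV e W := tlift (fun x v => tpure _ _ x (eV_map v)).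

Lemma AeeV_map_linear : linear AeeV_map.
Proof. exact: tlift_linear AeeV_map_balanced. Qed.

Lemma AeeV_map_pure x v : AeeV_map (tpure _ _ x v) = tpure _ _ x (eV_map v).
Proof. exact: tlift_pure AeeV_map_balanced. Qed.

Lemma counit_map t : counit (AeeV_map t) = f (counit t).
Proof.
have [fl fa] := hf.
move: t; apply: tens_ext => [r t u|r t u|x v].
- by rewrite AeeV_map_linear counit_linear.
- by rewrite counit_linear fl.
by rewrite AeeV_map_pure /counit !(tlift_pure _ _ (counit_balanced _ _)) /= fa.
Qed.

Lemma AeeV_map_surj : (forall w, exists v, f v = w) -> forall t, exists u, AeeV_map u = t.
Proof.
move=> fs t; rewrite [t]tensE; elim: (trep t) => [|[x [w wP]] s [u IHs]].
  by exists 0; rewrite big_nil (lin0 AeeV_map_linear).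
(* A preimage of [w] need not lie in [eV]; writing [w = e w'] and lifting [w'] to [v] gives the
   preimage [e v], which does. *)
have /imgP[w' Ew] := wP; have [v Ev] := fs w'.
exists (tpure _ _ x (ImgOf (in_eV e v)) + u); rewrite big_cons (linD AeeV_map_linear) IHs.
congr (_ + _); rewrite AeeV_map_pure; congr tpure; apply: val_inj => /=.
by rewrite Ew -Ev; case: hf.
Qed.

End Map.

Lemma AeeV_map_comp0 e U V W (f : U -> V) (g : V -> W)
    (hf : amod_hom f) (hg : amod_hom g) :
  (forall u, g (f u) = 0) -> forall t : AeeV e U, AeeV_map hg (AeeV_map hf t) = 0.
Proof.
move=> gf; apply: tens_ext => [r t u|r t u|x v]; last 1 first.
- rewrite !AeeV_map_pure.
  have -> : eV_map hg (eV_map hf v) = 0 by apply: val_inj; apply: gf.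
  by have [_ pr _] := tpure_balanced (@Ae_eAe _ _ e) (@eAe_eV _ _ e W); apply: lin0.
- by rewrite !AeeV_map_linear.
- by rewrite scaler0 addr0.
Qed.

Section Idempotent.
Variables (e : catalg C) (ee : amul e e = e) (V : amod C).
Implicit Types (v : V).

Lemma counit_ptens a v : counit (ptens e a v) = aact V (amul a e) v.
Proof.
rewrite /counit tlift_pure /=; last exact: counit_balanced.
by rewrite -aactM -amulA ee.
Qed.

(** An idempotent [e] fixes [Ae] from the right and [eV] from the left. This allows computing with
    pure tensors without carrying membership proofs. *)
Lemma tpure_ptens (x : Ae e) (v : eV e V) : tpure _ _ x v = ptens e (imgval x) (imgval v).
Proof.
case: x => x xP; case: v => v vP; congr tpure; apply: val_inj => /=.
  by case/imgP: xP => a ->; rewrite /amulr -amulA ee.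
by case/imgP: vP => w ->; rewrite -aactM ee.
Qed.

Lemma ptens_id a v : ptens e a (aact V e v) = ptens e a v.
Proof. by congr tpure; apply: val_inj; rewrite /= -aactM ee. Qed.

Lemma ptens_idl a v : ptens e (amul a e) v = ptens e a v.
Proof. by congr tpure; apply: val_inj; rewrite /= -amulA ee. Qed.

(** The two hypotheses put [s] in [eAe], so this is the balancing relation. *)
Lemma ptens_bal a s v : amul e s = s -> amul s e = s ->
  ptens e (amul a s) v = ptens e a (aact V s v).
Proof.
move=> es se; have [_ _ pb] := tpure_balanced (@Ae_eAe _ _ e) (@eAe_eV _ _ e V).
have sP : s \in img (acorner e) by apply/imgP; exists s; rewrite /= /acorner se es.
have := pb (ImgOf (in_Ae e a)) (ImgOf sP) (ImgOf (in_eV e v)).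
rewrite !tpure_ptens /= => E.
rewrite -(ptens_id (amul a s)) -(ptens_idl a).
rewrite -[in RHS]se aactM.
by rewrite -E -amulA es.
Qed.

End Idempotent.

End Modules.

(** * Extension along the tensor category *)

Section TildeTheory.
Context {R : comPzRingType} {C : lincat R}.

(** Adds the case [n = m] to [tcons_span]: there [tcons] is composition in [C], and [t] is its own
    composite with the identity of [m]. *)
Lemma tcons_spanW m n (t : tilde C m n.+1) : (m <= n)%N ->
  exists s : seq (hom C n n.+1 * tilde C m n), t = \sum_(p <- s) tcons p.1 p.2.
Proof.
rewrite leq_eqVlt => /predU1P[mn|]; last exact: tcons_span.
case: _ / mn t => t.
suff [f [u ->]] : exists f : hom C m m.+1, exists u : tilde C m m, t = tcons f u.
  by exists [:: (f, u)]; rewrite big_seq1.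
have [u Eu] : exists u : tilde C m m, teval u = idm C m.
  by case: (m) => [|k]; rewrite /= ?leqnSn; exists (idm C _).
move: t; rewrite /tcons /= leqnn => t.
by exists t, u; rewrite Eu compidr.
Qed.

(** For [n = m] and [n = m + 1] the tensor category has the same morphisms as [C], and [teval] is
    the identity. *)
Lemma teval_surj d : relations_generated C d -> forall m n, (m <= n)%N ->
  forall f : hom C m n, exists t : tilde C m n, teval t = f.
Proof.
move=> [surj _] m n mn f; have [mn2|] := leqP (m + 2) n; first exact: surj.
rewrite addn2 ltnS; case: n f mn => [|n] f mn nm; first by exists f.
by move: nm; rewrite ltnS /= => ->; exists f.
Qed.

End TildeTheory.

Section Extension.
Context {R : comPzRingType} {C : lincat R}.
Variables (d a N m : nat) (W : amod C) (y : W).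
Hypotheses (ma : (m < a)%N) (aN : (a <= N)%N) (adN : (a + d <= N.+1)%N).

Local Notation e := (eint C a N).

(* The lift of [h |-> h y] to the tensor category.  The value [0] is never
   used: [n' <= m] and [N <= n'] exclude each other when [m < N]. *)
Fixpoint tilde_ext n : tilde C m n -> AeeV e W :=
  match n return tilde C m n -> AeeV e W with
  | 0 => fun t => ptens e (eid C 0) (aact W (mor (@teval _ C m 0 t)) y)
  | n'.+1 => fun t =>
    if (n' < N)%N then ptens e (eid C n'.+1) (aact W (mor (@teval _ C m n'.+1 t)) y)
    else match (n' <= m)%N as b
      return (if b then hom_endmod C m n'.+1 else tens_endmod (tilde C m n')) ->
             AeeV e W with
    | true => fun=> 0
    | false => tlift (fun f t => AeeV_act (mor f) (tilde_ext t))
    end t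
  end.

Lemma tilde_ext_low n (t : tilde C m n) : (n <= N)%N ->
  tilde_ext t = ptens e (eid C n) (aact W (mor (teval t)) y).
Proof. by case: n t => [//|n] t nN; rewrite /= nN. Qed.

Lemma tilde_ext_low0 n (t : tilde C m n) : (n <= N)%N -> teval t = 0 ->
  tilde_ext t = 0.
Proof.
move=> nN t0; rewrite tilde_ext_low // t0 (lin0 (@mor_linear _ _ _ _)).
by rewrite (lin0 (aact_linearl _)) (lin0 (@ptens_linearr _ _ _ _ _)).
Qed.

(** A morphism between degrees in the window from [a] to [N] lies in [eAe], so it crosses the tensor
    sign. *)
Lemma ptens_mor k n (f : hom C k n) (w : W) : (a <= k <= N)%N -> (a <= n <= N)%N ->
  ptens e (mor f) w = ptens e (eid C n) (aact W (mor f) w).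
Proof.
move=> ak an; rewrite -(amul_eidl f) (@ptens_bal _ _ _ (eint_idem _ _)) ?amul_eidl //.
- exact: amul_eintl.
- exact: amul_eintr.
Qed.

Lemma tilde_ext_step_balanced n (f : tilde C m n -> AeeV e W) : linear f ->
    (forall g t, f (eop g t) = AeeV_act (mor g) (f t)) ->
  balanced (fun (h : hom C n n.+1) g => comp h g) (@eop _ _ n (tilde C m n))
    (fun h t => AeeV_act (mor h) (f t)).
Proof.
move=> fl fe; split=> [t r h h'|h r t u|h g t].
- by rewrite mor_linear AeeV_act_linearl.
- by rewrite fl AeeV_act_linear.
- by rewrite fe -AeeV_actM amul_mor.
Qed.

(** Linearity and equivariance go through one induction: beyond [N], equivariance in degree [n] is
    what makes the map given to [tlift] balanced over [End(n)]. Up to [N], equivariance is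
    [ptens_mor]. *)
Lemma tilde_ext_spec n : (a <= n)%N ->
  linear (@tilde_ext n) /\
  forall g (t : tilde C m n), tilde_ext (eop g t) = AeeV_act (mor g) (tilde_ext t).
Proof.
elim: n => [|n IHn] an; first by have := leq_trans ma an.
have [nN|Nn] := ltnP n N.
  split=> [r t u|g t].
    by rewrite !tilde_ext_low // teval_linear mor_linear aact_linearl ptens_linearr.
  rewrite !tilde_ext_low // teval_eop -amul_mor aactM ptens_actE amul_eidr.
  by rewrite ptens_mor ?an.
have {}an := leq_trans aN Nn.
have [fl fe] := IHn an.
have mn := leq_trans ma an.
have B := tilde_ext_step_balanced fl fe.
rewrite /= ltnNge Nn /= leqNgt mn /=.
split=> [|g t]; first exact: tlift_linear B.
have A := tens_act_balanced (tilde C m n) g.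
move: t; apply: tens_ext => [r t u|r t u|f t].
- by rewrite (tlift_linear A) (tlift_linear B).
- by rewrite (tlift_linear B) AeeV_act_linear.
- by rewrite (tlift_pure _ _ A) !(tlift_pure _ _ B) -AeeV_actM amul_mor.
Qed.

(** One rule for both regimes of [tilde_ext]: below [N] it comes from [ptens_mor], from [N] on it is
    the defining clause. *)
Lemma tilde_ext_tcons n f (t : tilde C m n) : (a <= n)%N ->
  tilde_ext (tcons f t) = AeeV_act (mor f) (tilde_ext t).
Proof.
move=> an; have [nN|Nn] := ltnP n N.
  rewrite !tilde_ext_low ?(ltnW nN) // teval_tcons -amul_mor aactM ptens_actE amul_eidr.
  by rewrite ptens_mor ?an ?(ltnW nN) ?(leqW an).
have [fl fe] := tilde_ext_spec an.
have B := tilde_ext_step_balanced fl fe.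
rewrite /tcons /= ltnNge Nn /= leqNgt (leq_trans ma an) /=.
exact: (tlift_pure _ _ B).
Qed.

Lemma counit_tilde_ext n (t : tilde C m n) : (a <= n)%N ->
  counit (tilde_ext t) = aact W (mor (teval t)) y.
Proof.
elim: n t => [|n IHn] t an; first by have := leq_trans ma an.
have [nN|Nn] := ltnP n N.
  rewrite tilde_ext_low // counit_ptens ?eint_idem // -aactM -amulA amul_eintl ?an //.
  by rewrite amul_eidl.
have {}an := leq_trans aN Nn; have mn := leq_trans ma an.
have [s ->] := tcons_span t mn.
rewrite (linear_sumE (proj1 (tilde_ext_spec (leqW an)))).
rewrite (linear_sumE (@counit_linear _ _ _ _)).
rewrite (linear_sumE (@teval_linear _ _ _ _)) (linear_sumE (@mor_linear _ _ _ _)).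
rewrite aact_suml.
apply: eq_bigr => p _.
by rewrite tilde_ext_tcons // counit_act IHn // teval_tcons -amul_mor aactM.
Qed.

(** Once the right factor has reached degree [a], [tilde_ext_tcons] peels off the factors of [s] one
    at a time. *)
Lemma tilde_ext_tcat r k (t : tilde C m r) (s : tilde C r (k + r)) : (a <= r)%N ->
  tilde_ext (tcat t s) = AeeV_act (mor (teval s)) (tilde_ext t).
Proof.
move=> ar; elim: k s => [|k IHk] s; first by have [_ ->] := tilde_ext_spec ar.
have [ss ->] := tcons_spanW s (leq_addl k r).
rewrite (linear_sumE (proj1 (tcat_spec k.+1 t))).
rewrite (linear_sumE (proj1 (tilde_ext_spec (leq_trans ar (leq_addl k.+1 r))))).
rewrite (linear_sumE (@teval_linear _ _ _ _)) (linear_sumE (@mor_linear _ _ _ _)).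
rewrite (linear_sumE (fun x => AeeV_act_linearl (tilde_ext t) x)).
apply: eq_bigr => p _.
rewrite tcat_tcons tilde_ext_tcons ?IHk; last exact: leq_trans ar (leq_addl _ _).
by rewrite teval_tcons -AeeV_actM amul_mor.
Qed.

Lemma tilde_ext_tcomp r n (t : tilde C m r) (s : tilde C r n) :
  (a <= r)%N -> (r <= n)%N ->
  tilde_ext (tcomp s t) = AeeV_act (mor (teval s)) (tilde_ext t).
Proof.
move=> ar rn; rewrite -(subnK rn) in s *.
by rewrite tcomp_tcat tilde_ext_tcat.
Qed.

(** While the total degree is at most [N], the concatenation is evaluated in [C] and vanishes; each
    later factor then acts on [0]. *)
Lemma tilde_ext_tcat_relations r k (t : tilde C m r) (s : tilde C r (k + r)) :
  in_relations t -> (r <= N)%N -> (a <= k + r)%N -> tilde_ext (tcat t s) = 0.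
Proof.
move=> t0 rN; elim: k s => [|k IHk] s ak.
  by rewrite tilde_ext_low0 // teval_tcat t0 comp0r.
have [kN|Nk] := leqP (k.+1 + r) N.
  by rewrite tilde_ext_low0 // teval_tcat t0 comp0r.
have ak' : (a <= k + r)%N := leq_trans aN Nk.
have [ss ->] := tcons_spanW s (leq_addl k r).
rewrite (linear_sumE (proj1 (tcat_spec k.+1 t))).
rewrite (linear_sumE (proj1 (tilde_ext_spec ak))) big1 // => p _.
by rewrite tcat_tcons tilde_ext_tcons // IHk // (lin0 (@AeeV_act_linear _ _ _ _ _)).
Qed.

Lemma tilde_ext_tcomp_relations r n (t : tilde C m r) (s : tilde C r n) :
  in_relations t -> (r <= N)%N -> (a <= n)%N -> (r <= n)%N -> tilde_ext (tcomp s t) = 0.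
Proof.
move=> t0 rN an rn; rewrite -(subnK rn) in s an *.
by rewrite tcomp_tcat tilde_ext_tcat_relations.
Qed.

Hypothesis relC : relations_generated C d.

(* A relation [s i t] with [i] from [r] to [r+d] is killed for one of two reasons:
   if [r+d <= N] then [i t] is evaluated in [C] within the range of [e], and
   otherwise [a <= r], so [s] and [i] act through [C]. *)
Lemma tilde_ext_relations n (t : tilde C m n) :
  (a <= n)%N -> in_relations t -> tilde_ext t = 0.
Proof.
move=> an t0; have [nN|Nn] := leqP n N.
  exact: tilde_ext_low0.
have tl := proj1 (tilde_ext_spec an).
(* [m + d <= a + d <= N + 1 <= n], so the generation of relations applies. *)
have mdn : (m + d <= n)%N.
  by apply: leq_trans Nn; apply: leq_trans adN; rewrite leq_add2r ltnW.
have [u [uP ->]] := (relC.2 m n mdn t).1 t0.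
rewrite (linear_sumE tl) big_nat big1 // => r /andP[mr]; rewrite ltnS => rn.
have rdn : (r + d <= n)%N by rewrite addnC -leq_subRL ?rn ?(leq_trans (leq_addl m d)).
have [s [sP ->]] := uP r (introT andP (conj mr rn)).
rewrite (linear_sumE tl) big_seq big1 // => -[[f i] g] /sP /= i0.
have [rN|Nr] := leqP (r + d) N.
  apply: tilde_ext_tcomp_relations => //; rewrite /in_relations teval_tcomp ?leq_addr //.
  by rewrite i0 comp0l.
(* Here [a + d <= N + 1 <= r + d]: the window is long enough for relations of length [d]. *)
have ar : (a <= r)%N by rewrite -(leq_add2r d) (leq_trans adN).
rewrite tilde_ext_tcomp ?(leq_trans ar) ?leq_addr // tilde_ext_tcomp ?leq_addr //.
rewrite i0 (lin0 (@mor_linear _ _ _ _)) (lin0 (AeeV_act_linearl _)).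
exact: (lin0 (@AeeV_act_linear _ _ _ _ _)).
Qed.

(** The map induced on [Hom(m,n)], through a chosen lift of [h]. For [a <= n] a lift exists, so the
    default [0] is not reached, and [tilde_ext_relations] makes the choice immaterial. *)
Definition ext n (h : hom C m n) : AeeV e W :=
  tilde_ext (xget 0 [set t | teval t = h]%classic).

Lemma ext_teval n (t : tilde C m n) : (a <= n)%N -> ext (teval t) = tilde_ext t.
Proof.
move=> an; have tl := proj1 (tilde_ext_spec an).
have E : teval (xget 0 [set u | teval u = teval t]%classic) = teval t.
  by apply: (xgetPex 0 (P := [set u | teval u = teval t]%classic)); exists t.
apply/eqP; rewrite -subr_eq0 -[- tilde_ext t]scaleN1r addrC -tl /ext.
by rewrite tilde_ext_relations // /in_relations teval_linear E scaleN1r addNr.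
Qed.

Let ext_lift n (h : hom C m n) : (a <= n)%N -> exists t : tilde C m n, teval t = h.
Proof. by move=> an; apply: (teval_surj relC); apply: ltnW (leq_trans ma an). Qed.

Lemma ext_linear n : (a <= n)%N -> linear (@ext n).
Proof.
move=> an r f g; have [t <-] := ext_lift f an; have [u <-] := ext_lift g an.
by rewrite -teval_linear !ext_teval // (proj1 (tilde_ext_spec an)).
Qed.

Lemma counit_ext n (h : hom C m n) : (a <= n)%N -> counit (ext h) = aact W (mor h) y.
Proof. by move=> an; have [t <-] := ext_lift h an; rewrite ext_teval // counit_tilde_ext. Qed.

(** Concatenating lifts of [f] and [g] lifts the composite; the lift of [f] acts through [C], and
    that of [g] ends inside the window, where [tilde_ext] is explicit. *)
Lemma ext_comp k n (f : hom C k n) (g : hom C m k) : (a <= k <= N)%N -> (a <= n)%N ->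
  ext (comp f g) = ptens e (mor f) (aact W (mor g) y).
Proof.
move=> /andP[ak kN] an; have [nk|kn] := ltnP n k.
  rewrite (hom_directed nk f) comp0l (lin0 (ext_linear an)).
  by rewrite (lin0 (@mor_linear _ _ _ _)) (lin0 (@ptens_linearl _ _ _ _ _)).
have [s <-] := teval_surj relC kn f; have [t <-] := ext_lift g ak.
rewrite -teval_tcomp // ext_teval // tilde_ext_tcomp // tilde_ext_low //.
by rewrite ptens_actE amul_eidr.
Qed.

End Extension.

(** * Free modules *)

Section Free.
Context {R : comPzRingType} {C : lincat R}.
Variables (d a N : nat).
Hypotheses (aN : (a <= N)%N) (adN : (a + d <= N.+1)%N).
Hypothesis relC : relations_generated C d.

Local Notation e := (eint C a N).

Lemma entry_amul_eid (x u : catalg C) j m n :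
  entry (amul (amul x (eid C j)) u) m n = comp (entry x j n) (entry u m j).
Proof.
rewrite entry_amul; under eq_bigr do rewrite entry_eidr.
have [nj|jn] := ltnP n j.
  rewrite (hom_directed nj (entry x j n)) comp0l big_nat big1 // => i /andP[_].
  by rewrite ltnS; case: eqP => [-> /leq_ltn_trans /(_ nj)|]; rewrite ?ltnn ?comp0l.
rewrite (bigD1_seq j) ?iota_uniq ?mem_index_iota //= eqxx.
by rewrite big1 ?addr0 // => i /negPf ->; rewrite comp0l.
Qed.

(** Nothing is lost by starting at [a]: a morphism with source [j >= a] and target below [a] is
    [0]. *)
Lemma sum_mor_entry (x : catalg C) M j : (forall m n, (M < n)%N -> entry x m n = 0) ->
  (a <= j)%N -> \sum_(a <= n < M.+1) mor (entry x j n) = amul x (eid C j).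
Proof.
move=> xM aj; under eq_bigr do rewrite mor_entry.
rewrite -(linear_sumE (amul_linearl _)); apply: catalgP => i k.
rewrite entry_eintl !entry_eidr; case: ifP => //; case: eqP => // -> /negbT.
rewrite negb_and -!ltnNge => /orP[ka|/xM -> //].
by rewrite (hom_directed (leq_trans ka aj) (entry x j k)).
Qed.

(** Recovers a tensor from the product [x e u] alone. That product is the sum of the [x e_j u] over
    the window, [ext_comp] splits each term at [j], and summing over [n] reassembles [x e_j]. *)
Lemma ext_entry (W : amod C) (x u : catalg C) M m (y : W) :
  (m < a)%N -> aact W (eid C m) y = y ->
  (forall i n, (M < n)%N -> entry x i n = 0) ->
  \sum_(a <= n < M.+1) ext a N y (entry (amul (amul x e) u) m n)
  = ptens e x (aact W u y).
Proof.
move=> ma ym xM.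
have E n : (a <= n)%N -> ext a N y (entry (amul (amul x e) u) m n) =
    \sum_(a <= j < N.+1) ptens e (mor (entry x j n)) (aact W (mor (entry u m j)) y).
  move=> an; have -> : amul (amul x e) u = \sum_(a <= j < N.+1) amul (amul x (eid C j)) u.
    by rewrite -(linear_sumE (amul_linearl u)) -(linear_sumE (amul_linearr x)).
  rewrite entry_sum (linear_sumE (ext_linear y ma aN adN relC an)) !big_nat.
  by apply: eq_bigr => j aj; rewrite entry_amul_eid (ext_comp _ ma aN adN relC).
rewrite big_nat; under eq_bigr => n /andP[an _] do rewrite E //.
rewrite -big_nat exchange_big_nat /= -(ptens_id (eint_idem a N)) aact_suml.
rewrite (linear_sumE (@ptens_linearr _ _ e _ _)) !big_nat.
apply: eq_bigr => j /andP[aj jN].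
have Ej : amul e (eid C j) = eid C j by rewrite eidE amul_eintl ?aj.
have jE : amul (eid C j) e = eid C j by rewrite eidE amul_eintr ?aj.
rewrite -(ptens_bal (eint_idem a N) _ _ Ej jE) -(sum_mor_entry xM aj).
rewrite (linear_sumE (fun b => @ptens_linearl _ _ e _ _ b)); apply: eq_bigr => n _.
(* Since [y] has degree [m], the entry of [u] at [(m, j)] sends [y] to [e_j u y], and [e_j] is
   absorbed by a morphism with source [j]. *)
rewrite (mor_entry u) !aactM ym -(ptens_bal (eint_idem a N) _ _ Ej jE).
by rewrite amul_eidr.
Qed.

Section Coordinates.
Variables (I : eqType) (K : nat).
Hypothesis Ka : (K < a)%N.

Local Notation e0 := (eint C 0 K).
Local Notation P := (dsum_mod (fun _ : I => Ae_mod e0)).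

Definition coef (x : P) (i : I) : catalg C := imgval (dval x i).

(** For [m <= K] this is [e_m] in the summand [i], as [e_m e_{0,K} = e_m]; it is homogeneous of
    degree [m], as [ext_entry] requires. *)
Definition free_gen (i : I) (m : nat) : P :=
  @dinj R I (fun=> acar (Ae_mod e0)) i (ImgOf (in_Ae e0 (eid C m))).

Lemma dinj_act i b (z : Ae e0) :
  aact P b (@dinj R I (fun=> acar (Ae_mod e0)) i z) =
  @dinj R I (fun=> acar (Ae_mod e0)) i (Ae_act b z).
Proof.
apply: dsumP => j; have [ij|ij] := eqVneq i j.
  case: _ / ij; rewrite dinjE.
  by congr Ae_act; rewrite dinjE.
rewrite dinj_out //.
by apply: etrans (lin0 (@Ae_act_linear _ _ e0 b)); congr Ae_act; rewrite dinj_out.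
Qed.

Lemma eid_free_gen i m : aact P (eid C m) (free_gen i m) = free_gen i m.
Proof.
rewrite dinj_act; congr dinj; apply: val_inj => /=.
by rewrite amulA eidE amul_mor compidl.
Qed.

(** A coefficient [z] in [A e_{0,K}] satisfies [z = z e_{0,K}], and [e_{0,K}] is the sum of the
    [e_m]. *)
Lemma free_decomp (x : P) : exists L : seq I, forall L', uniq L' -> {subset L <= L'} ->
  x = \sum_(i <- L') \sum_(0 <= m < K.+1) aact P (coef x i) (free_gen i m).
Proof.
have [L HL] := @dsum_decomp R I (fun=> acar (Ae_mod e0)) x.
exists L => L' uL sL; rewrite [LHS](HL L' uL sL); apply: eq_bigr => i _.
under eq_bigr do rewrite dinj_act.
rewrite -(linear_sumE (@dinj_linear R I (fun=> acar (Ae_mod e0)) i)); congr dinj.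
apply: val_inj; rewrite /= (linear_sumE (f := val)) //=.
rewrite -(linear_sumE (amul_linearr _)) -(linear_sumE (amul_linearl _)) -/e0.
rewrite eint_idem /coef; case: (dval x i) => z /= /imgP[b ->].
by rewrite /amulr -amulA eint_idem.
Qed.

(* Quantifying over all larger [L] and [M] lets expansions of two tensors be added. *)
Lemma free_expansion (t : AeeV e P) : exists (L : seq I) (M : nat),
  forall L' M', uniq L' -> {subset L <= L'} -> (M <= M')%N ->
  t = \sum_(i <- L') \sum_(0 <= m < K.+1) \sum_(a <= n < M'.+1)
        ext a N (free_gen i m) (entry (coef (counit t) i) m n).
Proof.
pose Q (t : AeeV e P) := exists (L : seq I) (M : nat),
  forall L' M', uniq L' -> {subset L <= L'} -> (M <= M')%N ->
  t = \sum_(i <- L') \sum_(0 <= m < K.+1) \sum_(a <= n < M'.+1)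
        ext a N (free_gen i m) (entry (coef (counit t) i) m n).
rewrite -/(Q t) [t]tensE; elim/big_rec: _ => [|[x v] u _ [L1 [M1 Q1]]].
  exists [::], 0%N => L M _ _ _; rewrite (lin0 (@counit_linear _ _ _ _)).
  rewrite big1 // => i _; rewrite big_nat big1 // => m /andP[_ mK].
  rewrite big_nat big1 // => n /andP[an _].
  exact: (lin0 (ext_linear _ (leq_trans mK Ka) aN adN relC an)).
have [M2 xM] := catalg_bounded (imgval x).
have [L2 vL] := free_decomp (imgval v).
exists (L1 ++ L2), (maxn M1 M2) => L M uL sL; rewrite geq_max => /andP[M1M M2M].
have sL1 : {subset L1 <= L} by move=> i iL; apply: sL; rewrite mem_cat iL.
have sL2 : {subset L2 <= L} by move=> i iL; apply: sL; rewrite mem_cat iL orbT.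
(* The new pure tensor is expanded in the generators by [free_decomp]; [ext_entry] then rewrites
   each piece through the coefficients of its image under [counit]. *)
rewrite {1}(Q1 L M uL sL1 M1M) {1}(tpure_ptens (eint_idem a N)).
rewrite {1}(vL L uL sL2) (linear_sumE (@ptens_linearr _ _ _ _ _)) -big_split /=.
apply: eq_bigr => i _.
rewrite (linear_sumE (@ptens_linearr _ _ _ _ _)) -big_split /= !big_nat.
apply: eq_bigr => m /andP[_ mK]; have ma := leq_trans mK Ka.
rewrite -(ext_entry _ ma (eid_free_gen i m) (M := M)); last first.
  by move=> j n Mn; apply: xM; apply: leq_ltn_trans Mn.
rewrite -big_split /= !big_nat; apply: eq_bigr => n /andP[an _].
rewrite -(linD (ext_linear _ ma aN adN relC an)); congr ext.
rewrite (linD (@counit_linear _ _ _ _)) (tpure_ptens (eint_idem a N)).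
by rewrite counit_ptens ?eint_idem.
Qed.

(** The expansion of [t] depends on [t] only through [counit t]. *)
Lemma counit_free_inj (t : AeeV e P) : counit t = 0 -> t = 0.
Proof.
move=> t0; have [L [M E]] := free_expansion t.
rewrite (E (undup L) M (undup_uniq L) _ (leqnn M)); last first.
  by move=> i; rewrite mem_undup.
rewrite big1 // => i _; rewrite big_nat big1 // => m /andP[_ mK].
rewrite big_nat big1 // => n /andP[an _]; rewrite t0.
exact: (lin0 (ext_linear _ (leq_trans mK Ka) aN adN relC an)).
Qed.

Lemma counit_free_surj M (x : P) : exists t : AeeV e P, counit t = aact P (eint C a M) x.
Proof.
have [L E] := free_decomp x.
(* The formula of [free_expansion], with the coefficients of [x] in place of those of [counit t]. *)
exists (\sum_(i <- undup L) \sum_(0 <= m < K.+1) \sum_(a <= n < M.+1)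
        ext a N (free_gen i m) (entry (coef x i) m n)).
rewrite {2}(E (undup L) (undup_uniq L)); last by move=> i; rewrite mem_undup.
rewrite !(linear_sumE (@counit_linear _ _ _ _)) linear_sum; apply: eq_bigr => i _.
rewrite !(linear_sumE (@counit_linear _ _ _ _)) linear_sum !big_nat.
apply: eq_bigr => m /andP[_ mK]; have ma := leq_trans mK Ka.
rewrite !(linear_sumE (@counit_linear _ _ _ _)) aact_suml !big_nat.
apply: eq_bigr => n /andP[an _].
by rewrite (counit_ext _ ma aN adN relC) // mor_entry !aactM eid_free_gen.
Qed.

End Coordinates.

(** The sources of [x e] lie between [a] and [N], so by directedness its targets are at least [a];
    [catalg_bounded] bounds them above. *)
Lemma counit_tail (W : amod C) (t : AeeV e W) :
  exists M, aact W (eint C a M) (counit t) = counit t.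
Proof.
suff [M HM] : exists M, forall M', (M <= M')%N ->
    aact W (eint C a M') (counit t) = counit t.
  by exists M; apply: HM.
rewrite [t]tensE; elim/big_rec: _ => [|[x v] u _ [M1 Q1]].
  by exists 0%N => M _; rewrite (lin0 (@counit_linear _ _ _ _)) linear0.
have [M2 xM] := catalg_bounded (imgval x).
exists (maxn M1 M2) => M; rewrite geq_max => /andP[M1M M2M].
rewrite (linD (@counit_linear _ _ _ _)) linearD Q1 //; congr (_ + _).
rewrite (tpure_ptens (eint_idem a N)) counit_ptens ?eint_idem // -aactM.
congr (aact W _ _).
apply: catalgP => m n; rewrite entry_eintl entry_eintr.
case: (boolP (a <= n <= M)%N) => //; rewrite negb_and -!ltnNge => /orP[na|Mn].
  case: ifP => // /andP[am _]; exact/esym/(hom_directed (leq_trans na am)).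
by rewrite xM ?if_same // (leq_ltn_trans M2M).
Qed.

End Free.

(** * Tails and the diagram chase *)

Lemma tail_eint (R : comPzRingType) (C : lincat R) (V : amod C) k (v : V) :
  tail k v <-> exists M, aact V (eint C k M) v = v.
Proof.
split=> [[N [w [wP ->]]]|[M E]]; last first.
  exists M.+1, (fun n => aact V (eid C n) v); split=> [n|]; first exact: in_eV.
  by rewrite -{1}E aact_suml.
exists N; rewrite linear_sum !big_nat; apply: eq_bigr => n /andP[kn nN].
have /imgP[v' ->] := wP n.
by rewrite -aactM eidE amul_eintl // kn ltnW.
Qed.

Theorem theorem4p5 (R : comPzRingType) (C : lincat R) (d : nat)
    (d_ge1 : (1 <= d)%N) (relC : relations_generated C d)
    (V : amod C) (gradedV : graded V)
    (presV : presented_in_finite_degrees V) :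
  centrally_stable d V.
Proof.
have [K [I [J [f [g [hf hg ex gs]]]]]] := presV.
(* This bound gives [K < a], so all generators of the presentation lie below the window. *)
exists (K + d)%N => N KN; set a := (N - (d - 1))%N.
have Ka : (K < a)%N by rewrite /a; lia.
have aN : (a <= N)%N by rewrite /a; lia.
have adN : (a + d <= N.+1)%N by rewrite /a; lia.
(* [{classic I}] equips the bare index type with the equality needed for the coordinates. *)
have ci := @counit_free_inj _ _ d a N aN adN relC {classic I} K Ka.
have cs := @counit_free_surj _ _ d a N aN adN relC {classic J} K Ka.
have cs' := @counit_free_surj _ _ d a N aN adN relC {classic I} K Ka.
have [gl ga] := hg; have [fl fa] := hf.
exists (@counit _ _ (eint C a N) V); split.
- split; [exact: counit_linear|exact: counit_act].
- have inj0 (t : AeeV (eint C a N) V) : counit t = 0 -> t = 0.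
    have [t0 <-] := AeeV_map_surj hg gs t.
    rewrite counit_map => /(proj1 (ex _)) [y Ey].
    (* Only the truncation [e_{a,M} y] is known to lift along [counit]; it suffices, since [f]
       commutes with [e_{a,M}], which fixes [counit t0 = f y]. *)
    have [M EM] := counit_tail t0.
    have [t1 Et1] := cs M y.
    have -> : t0 = AeeV_map hf t1.
      apply/eqP; rewrite -subr_eq0; apply/eqP; apply: ci.
      rewrite -[- _]scaleN1r addrC counit_linear counit_map Et1 fa Ey EM.
      by rewrite scaleN1r addNr.
    by apply: AeeV_map_comp0 => u; apply/ex; exists u.
  move=> t u tu; apply/eqP; rewrite -subr_eq0; apply/eqP; apply: inj0.
  by rewrite -[- _]scaleN1r addrC counit_linear tu scaleN1r addNr.
- move=> v; rewrite tail_eint; split=> [[M <-]|[t <-]]; last exact: counit_tail.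
  have [x <-] := gs v; have [t Et] := cs' M x.
  by exists (AeeV_map hg t); rewrite counit_map Et ga.
Qed.
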